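(* Let $R$ be a ring and $M$ a left $R$-module. Then there is an inverse system $(I_\alpha,p_{\alpha\beta})_{\alpha\leq\beta<\omega_1}$ of injective left $R$-modules, with connecting maps $p_{\alpha\beta}:I_\beta\to I_\alpha$ for $\alpha\le\beta<\omega_1$, such that every $p_{\alpha\beta}$ is a split epimorphism and $M\cong\varprojlim_{\alpha<\omega_1} I_\alpha$ as left $R$-modules.
   Context: Rings are unital and associative, but not necessarily commutative; all modules are unital left modules. $\omega_1$ denotes the first uncountable ordinal. An inverse system indexed by $\omega_1$ consists of modules $I_\alpha$ ($\alpha<\omega_1$) and $R$-linear maps $p_{\alpha\beta}:I_\beta\to I_\alpha$ for $\alpha\leq\beta<\omega_1$, with $p_{\alpha\alpha}=\mathrm{id}$ and $p_{\alpha\beta}p_{\beta\gamma}=p_{\alpha\gamma}$ for $\alpha\le\beta\le\gamma<\omega_1$. A split epimorphism is an $R$-linear map having an $R$-linear right inverse (section). *)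

(* Defs.v *)
From HB Require Import structures.
From mathcomp Require Import all_boot all_order all_algebra.
From mathcomp Require Import boolp classical_sets functions cardinality.
From mathcomp Require wochoice.

Set Implicit Arguments.
Unset Strict Implicit.
Unset Printing Implicit Defensive.

Import Order.TTheory GRing.Theory.

Local Open Scope classical_set_scope.
Local Open Scope ring_scope.

(** [pzRingType]: unital associative rings, not necessarily commutative, and
    possibly zero; [lmodType R]: unital left [R]-modules. *)

Definition injective_module (R : pzRingType) (I : lmodType R) : Prop :=
  forall (A B : lmodType R) (i : {linear A -> B}) (g : {linear A -> I}),
    injective i -> exists h : {linear B -> I}, forall x : A, h (i x) = g x.

Definition split_epi (R : pzRingType) (U V : lmodType R)
    (f : {linear U -> V}) : Prop :=
  exists s : {linear V -> U}, forall y : V, f (s y) = y.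

Definition lmod_isomorphic (R : pzRingType) (U V : lmodType R) : Prop :=
  exists f : {linear U -> V}, bijective f.

(** Fix a well-ordering of the uncountable set [set nat]. Its elements that
    have only countably many elements below them form an initial segment, which
    is uncountable: otherwise the least element outside of it would belong to
    it. All its proper initial segments are countable, so that its order type
    is the first uncountable ordinal. *)

Definition wo_le : rel (set nat) :=
  sval (wochoice.well_ordering_principle (set nat)).

Definition omega1 : Type :=
  {x : set nat | `[< countable [set y | wo_le y x] >]}.

HB.instance Definition _ := Choice.on omega1.

Section WoLe.

Let woP : wochoice.well_order wo_le.
Proof. exact: svalP (wochoice.well_ordering_principle (set nat)). Qed.

Let chainT : wochoice.wo_chain wo_le predT.
Proof. by move=> A _; apply: woP. Qed.

Lemma wo_le_refl : reflexive wo_le.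
Proof. by move=> x; apply: (wochoice.wo_chain_reflexive chainT). Qed.

Lemma wo_le_anti : antisymmetric wo_le.
Proof. by move=> x y; apply: (wochoice.wo_chain_antisymmetric chainT). Qed.

Lemma wo_le_total : total wo_le.
Proof. by move=> x y; apply: (wochoice.wo_chainW chainT). Qed.

Lemma wo_le_min (A : set (set nat)) :
  A !=set0 -> exists2 x, A x & forall y, A y -> wo_le x y.
Proof.
case=> a Aa.
have [|x [[xA xmin] _]] := woP (A := [pred z | `[< A z >]]).
  by exists a; rewrite inE.
exists x; first by move: xA; rewrite inE.
by move=> y Ay; apply: xmin; rewrite inE.
Qed.

Lemma wo_le_trans : transitive wo_le.
Proof.
move=> y x z xy yz.
have xA : [set x; y; z] x by left; left.
have [|m Am mmin] := @wo_le_min [set x; y; z]; first by exists x.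
have mx : wo_le m x by apply: mmin; left; left.
have my : wo_le m y by apply: mmin; left; right.
have mz : wo_le m z by apply: mmin; right.
case: Am => [[]|] /= Em; rewrite {m mmin}Em in mx my mz => //.
  by have -> : x = y by apply: wo_le_anti; rewrite xy mx.
by have <- : y = z by apply: wo_le_anti; rewrite yz my.
Qed.

End WoLe.

Fact omega1_display : Order.disp_t. Proof. exact: Order.Disp tt tt. Qed.

Definition omega1_le : rel omega1 := fun a b => wo_le (val a) (val b).

Fact omega1_le_refl : reflexive omega1_le.
Proof. by move=> a; apply: wo_le_refl. Qed.

Fact omega1_le_anti : antisymmetric omega1_le.
Proof. by move=> a b /wo_le_anti /val_inj. Qed.

Fact omega1_le_trans : transitive omega1_le.
Proof. by move=> b a c; apply: wo_le_trans. Qed.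

HB.instance Definition _ := Order.Le_isPOrder.Build omega1_display omega1
  omega1_le_refl omega1_le_anti omega1_le_trans.

Fact omega1_le_total : total (<=%O : rel omega1).
Proof. by move=> a b; apply: wo_le_total. Qed.

HB.instance Definition _ :=
  Order.POrder_isTotal.Build omega1_display omega1 omega1_le_total.

(** The next three lemmas characterize [omega1] up to isomorphism of orders. *)

Lemma omega1_well_order (A : set omega1) :
  A !=set0 -> exists2 a, A a & forall b, A b -> (a <= b)%O.
Proof.
case=> a Aa.
have [|_ [x Ax <-] xmin] := @wo_le_min (val @` A); first by exists (val a), a.
by exists x => // b Ab; apply: xmin; exists b.
Qed.

Lemma omega1_countable_segment (a : omega1) : countable [set b | (b < a)%O].
Proof.
have /asboolP/countable_injP[f fI] := valP a.
apply/countable_injP; exists (f \o val) => b c.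
rewrite !inE => /ltW ba /ltW ca /fI bc.
by apply: val_inj; apply: bc; rewrite inE.
Qed.

Lemma omega1_uncountable : ~ countable [set: omega1].
Proof.
case/countable_injP=> f fI.
pose W := [set x | countable [set y | wo_le y x]].
pose g x := if pselect (W x) is left Wx
            then f (exist _ x (introT (asboolP _) Wx)) else 0%N.
have gI x y : W x -> W y -> g x = g y -> x = y.
  rewrite /g; case: pselect => // Wx _; case: pselect => // Wy _ fxy.
  by have := fI _ _ (mem_set I) (mem_set I) fxy => /(congr1 val).
have [WT|/existsNP[x nWx]] := pselect (forall x, W x).
  pose D := [set n | exists2 A : set nat, g A = n & ~ A n].
  have [D1|D1] := pselect (D (g D)).
    by have [A /gI AD nA] := D1; apply: nA; rewrite AD.
  by apply: (D1); exists D.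
have [|m nWm mmin] := @wo_le_min (~` W); first by exists x.
have Wlt y : wo_le y m -> y <> m -> W y.
  by move=> ym ynm; apply: contrapT => /mmin my; apply/ynm/wo_le_anti/andP.
apply: nWm; apply/countable_injP.
exists (fun y => if y == m then 0%N else (g y).+1) => y z.
rewrite !inE /= => ym zm.
case: eqVneq => [->|/eqP ynm]; case: eqVneq => [->|/eqP znm] //.
by case; apply: gI; apply: Wlt.
Qed.

(** The map [is_map : M_b -> M_a] is indexed by a proof of [a <= b]; this is a
    boolean statement, so its proofs are all equal. *)
Record inverse_system (R : pzRingType) d (T : porderType d) := InverseSystem {
  is_obj :> T -> lmodType R;
  is_map : forall a b : T, (a <= b)%O -> {linear is_obj b -> is_obj a};
  is_map_id : forall (a : T) (aa : (a <= a)%O) (x : is_obj a),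
    is_map aa x = x;
  is_map_comp : forall (a b c : T)
      (ab : (a <= b)%O) (bc : (b <= c)%O) (ac : (a <= c)%O) (x : is_obj c),
    is_map ab (is_map bc x) = is_map ac x
}.

(** The inverse limit: the submodule of the product of all the modules
    consisting of the compatible families. *)
Record invlim (R : pzRingType) d (T : porderType d)
    (S : inverse_system R T) : Type := InvLim {
  thread :> forall a : T, S a;
  threadP : forall (a b : T) (ab : (a <= b)%O),
    is_map S ab (thread b) = thread a
}.

Section InvLimModule.
Context (R : pzRingType) d (T : porderType d) (S : inverse_system R T).
Implicit Types u v w : invlim S.

Lemma invlim_eq u v : (forall a, u a = v a) -> u = v.
Proof.
case: u v => [u uP] [v vP] /= uv.
have uv' : u = v by apply: functional_extensionality_dep.
by case: _ / uv' vP => vP; rewrite (Prop_irrelevance uP vP).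
Qed.

HB.instance Definition _ := gen_eqMixin (invlim S).
HB.instance Definition _ := gen_choiceMixin (invlim S).

Definition invlim_zero : invlim S.
Proof. by exists (fun=> 0) => a b ab; rewrite linear0. Defined.

Definition invlim_opp u : invlim S.
Proof. by exists (fun a => - u a) => a b ab; rewrite linearN threadP. Defined.

Definition invlim_add u v : invlim S.
Proof.
by exists (fun a => u a + v a) => a b ab; rewrite linearD !threadP.
Defined.

Definition invlim_scale (r : R) u : invlim S.
Proof. by exists (fun a => r *: u a) => a b ab; rewrite linearZ threadP. Defined.

Fact invlim_addA : associative invlim_add.
Proof. by move=> u v w; apply: invlim_eq => a /=; rewrite addrA. Qed.

Fact invlim_addC : commutative invlim_add.
Proof. by move=> u v; apply: invlim_eq => a /=; rewrite addrC. Qed.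

Fact invlim_add0 : left_id invlim_zero invlim_add.
Proof. by move=> u; apply: invlim_eq => a /=; rewrite add0r. Qed.

Fact invlim_addN : left_inverse invlim_zero invlim_opp invlim_add.
Proof. by move=> u; apply: invlim_eq => a /=; rewrite addNr. Qed.

HB.instance Definition _ := GRing.isZmodule.Build (invlim S)
  invlim_addA invlim_addC invlim_add0 invlim_addN.

Fact invlim_scaleA r s u :
  invlim_scale r (invlim_scale s u) = invlim_scale (r * s) u.
Proof. by apply: invlim_eq => a /=; rewrite scalerA. Qed.

Fact invlim_scale1 : left_id 1 invlim_scale.
Proof. by move=> u; apply: invlim_eq => a /=; rewrite scale1r. Qed.

Fact invlim_scaleDr : right_distributive invlim_scale +%R.
Proof. by move=> r u v; apply: invlim_eq => a /=; rewrite scalerDr. Qed.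

Fact invlim_scaleDl u : {morph invlim_scale^~ u : r s / r + s}.
Proof. by move=> r s; apply: invlim_eq => a /=; rewrite scalerDl. Qed.

HB.instance Definition _ := GRing.Zmodule_isLmodule.Build R (invlim S)
  invlim_scaleA invlim_scale1 invlim_scaleDr invlim_scaleDl.

End InvLimModule.

(* Main.v *)
Require Import Defs.
From HB Require Import structures.
From mathcomp Require Import all_boot all_order all_algebra.
From mathcomp Require Import boolp classical_sets functions cardinality.
From mathcomp Require Import finmap ring.

Set Implicit Arguments.
Unset Strict Implicit.
Unset Printing Implicit Defensive.

Import Order.TTheory GRing.Theory Num.Theory.

(** The module [M] is the kernel of a linear map [f : E -> F] between injective
    modules: embed [M] into an injective [E], then [E / M] into an injective
    [F]. Both can be taken coinduced, that is of the form [Hom_Z(R, K)] with [K]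
    a divisible abelian group: by the adjunction
    [Hom_R(A, Hom_Z(R, K)) = Hom_Z(A, K)] such a module is injective as soon as
    [K] is ([coind_extend]), and the characters [V -> Q/Z] that vanish on a
    submodule [B] form a linear map from [V] to a coinduced module with kernel
    exactly [B] ([submodule_kernel]).

    Write [F = Hom_Z(R, D)]. The point of coinduced modules is that over the
    integers, direct sums of injectives are injective, while over [R] they need
    not be. Let [X_a] be the set of finite-to-one functions
    [e : {c | c <= a} -> nat], and let [D_a] be the direct sum of copies of [D]
    indexed by [X_a], seen as the group of finitely supported [D]-valued
    measures on [X_a]. It is divisible, and pushing measures forward along the
    restrictions [X_b -> X_a] makes an inverse system of these groups. Take

      [I_a = {(x, h) in E * Hom_Z(R, D_a) | mass (h r) = f x r for all r}],

    the pullback of [f] along the map [Hom_Z(R, D_a) -> F] given by the total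
    mass.

    - [I_a] is injective: a point mass at some [e] in [X_a] corrects the total
      mass linearly, so that [I_a] is a retract of [E * Hom_Z(R, D_a)]
      ([stage_injective]).
    - [I_b -> I_a] is a split epimorphism: functions in [X_a] extend to [X_b]
      by a fixed element of [X_b], and pushing forward along this extension
      preserves the total mass ([stage_map_split]).
    - The limit of the groups [D_a] is zero ([fin_to_one_thread_eq0]). Given a
      nonzero compatible family, choose for each ordinal [c] a function [e]
      charged by the family at some stage beyond [c], and set [n c = e c]. For
      fixed [b], all the pairs [(c, n c)] with [c <= b] lie on the graphs of
      the finitely many functions charged at one later stage; each of these is
      finite-to-one, so that [n] is finite-to-one on [{c | c <= b}]. This for
      all [b] makes [omega1] countable, a contradiction.

    Hence the limit of the modules [I_a] consists of the constant families
    [(x, 0)] with [f x = 0], and this is [M] ([stage_system_lim]). *)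

Local Open Scope classical_set_scope.
Local Open Scope ring_scope.

(** * Extension of homomorphisms to divisible groups *)

Definition is_subgroup (A : zmodType) (S : set A) : Prop :=
  S 0 /\ forall x y, S x -> S y -> S (x - y).

Lemma subgroupD (A : zmodType) (S : set A) (x y : A) :
  is_subgroup S -> S x -> S y -> S (x + y).
Proof.
case=> S0 SB Sx Sy; rewrite -[y]opprK; apply: (SB) => //.
by rewrite -sub0r; apply: SB.
Qed.

Lemma subgroupN (A : zmodType) (S : set A) (x : A) :
  is_subgroup S -> S x -> S (- x).
Proof. by case=> S0 SB Sx; rewrite -sub0r; apply: SB. Qed.

Lemma subgroupMn (A : zmodType) (S : set A) (x : A) (n : nat) :
  is_subgroup S -> S x -> S (x *+ n).
Proof.
move=> sS Sx; elim: n => [|n IHn]; first by case: sS.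
by rewrite mulrS; apply: subgroupD.
Qed.

Lemma subgroupMz (A : zmodType) (S : set A) (x : A) (k : int) :
  is_subgroup S -> S x -> S (x *~ k).
Proof.
move=> sS Sx; case: k => n; first exact: subgroupMn.
by rewrite NegzE mulrNz; apply: subgroupN => //; apply: subgroupMn.
Qed.

(** Applied to the integers [k] such that [k] times an element lies in a given
    subgroup; the generator [n = 0] means that no nonzero multiple does. *)
Lemma subgroup_int (S : set int) :
  is_subgroup S -> exists n : nat, forall k : int, S k <-> (n %| k)%Z.
Proof.
move=> sS; pose P n := (0 < n)%N && `[< S n%:Z >].
have [exP|noP] := pselect (exists n, P n); last first.
  exists 0%N => k; rewrite dvd0z; split=> [Sk|/eqP->]; last by case: sS.
  apply/contraT; rewrite -absz_gt0 => k_gt0; case: noP; exists `|k|%N.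
  rewrite /P k_gt0; apply/asboolP; rewrite abszE.
  by have [_|_] := ger0P k => //; apply: subgroupN.
case: (ex_minnP exP) => n /andP[n_gt0 /asboolP Sn] nmin.
have Smul q : S (q * n%:Z) by rewrite mulrC -mulrzz; apply: subgroupMz.
exists n => k; split=> [Sk|/dvdzP[q ->]]; last exact: Smul.
have Sr : S (k %% n)%Z by apply: (proj2 sS).
apply/dvdz_mod0P; apply: contrapT => /eqP r0.
have n0 : n%:Z != 0 by rewrite eqz_nat -lt0n.
move: (modz_ge0 k n0) (@ltz_pmod k n n_gt0) Sr r0.
case: (k %% n)%Z => // r _ rn Sr r0.
have : P r by rewrite /P lt0n r0; apply/asboolP.
by move=> /nmin nr; move: rn; rewrite ltz_nat ltnNge nr.
Qed.

Section Divisible.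
Variables (A D : zmodType).

(** Divisibility is stated for a subgroup [P] of [D], so that the extension
    theorem can keep the values of a homomorphism inside [P]. *)
Definition divisible (P : set D) : Prop :=
  forall n d, (0 < n)%N -> P d -> exists2 c, P c & c *+ n = d.

(** Partial homomorphisms from [A] to [D] are encoded by their graphs, which are
    subgroups of [A * D]; the union of a chain of them is then immediate. For
    a subgroup, being single-valued at 0 is being single-valued. *)
Definition functional (G : set (A * D)) : Prop := forall y, G (0, y) -> y = 0.

Lemma pairMz (a : A) (d : D) (k : int) : (a, d) *~ k = (a *~ k, d *~ k).
Proof.
rewrite [LHS]surjective_pairing; congr (_, _); first exact: (raddfMz fst).
exact: (raddfMz snd).
Qed.

Lemma functionalP (G : set (A * D)) x y z : is_subgroup G -> functional G ->
  G (x, y) -> G (x, z) -> y = z.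
Proof.
move=> [_ GB] Gf Gy Gz; apply/eqP; rewrite -subr_eq0; apply/eqP/Gf.
by have := GB _ _ Gy Gz; rewrite /GRing.add /= /add_pair /= subrr.
Qed.

Definition adjoin (G : set (A * D)) (a : A) (d : D) : set (A * D) :=
  [set p | exists2 q, G q & exists k : int, p = q + (a, d) *~ k].

(** The hypothesis on [d] says that the partial homomorphism agrees with
    [k a |-> k d] where both are defined; this is all that is needed to extend
    it by [a |-> d]. *)
Lemma adjoin_graph (G : set (A * D)) a d (P : set D) :
  is_subgroup G -> functional G -> is_subgroup P -> (forall p, G p -> P p.2) ->
  P d -> (forall k y, G (a *~ k, y) -> y = d *~ k) ->
  [/\ is_subgroup (adjoin G a d), functional (adjoin G a d),
      forall p, adjoin G a d p -> P p.2, G `<=` adjoin G a d &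
      adjoin G a d (a, d)].
Proof.
move=> sG fG sP GP Pd compat; split.
- split; first by exists 0; [case: sG|exists 0; rewrite mulr0z addr0].
  move=> _ _ [p Gp [k ->]] [q Gq [l ->]]; exists (p - q).
    exact: (proj2 sG).
  by exists (k - l); rewrite mulrzBr opprD addrACA.
- move=> y [[u v] Guv [k]]; rewrite pairMz => -[u0 ->].
  have /compat : G (a *~ k, - v).
    have -> : a *~ k = - u by apply/eqP; rewrite -addr_eq0 addrC -u0.
    exact: (@subgroupN _ G (u, v)).
  by move/eqP; rewrite eqr_oppLR => /eqP ->; rewrite addNr.
- move=> _ [[u v] Guv [k ->]]; rewrite pairMz /=.
  by apply: subgroupD => //; [apply: (GP (u, v))|apply: subgroupMz].
- by move=> p Gp; exists p => //; exists 0; rewrite mulr0z addr0.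
- by exists 0; [case: sG|exists 1; rewrite add0r mulr1z].
Qed.

(** The only constraint on the value at [a] comes from the first positive
    multiple [n a] in the domain: divide its image by [n]. *)
Lemma compatible_value (G : set (A * D)) a (P : set D) :
  is_subgroup G -> functional G -> is_subgroup P -> divisible P ->
  (forall p, G p -> P p.2) ->
  exists2 d, P d & forall k y, G (a *~ k, y) -> y = d *~ k.
Proof.
move=> sG fG sP dP GP.
have [n nP] : exists n : nat, forall k : int,
    (exists y, G (a *~ k, y)) <-> (n %| k)%Z.
  apply: subgroup_int; split; first by exists 0; rewrite mulr0z; case: sG.
  move=> k l [y Gy] [z Gz]; exists (y - z).
  by rewrite mulrzBr; apply: (proj2 sG _ _ Gy Gz).
have [y0 Gy0] : exists y, G (a *~ n, y) by apply/nP.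
have [n0|n_gt0] := posnP n.
  exists 0 => [|k y Gy]; first by case: sP.
  have /nP : exists y, G (a *~ k, y) by exists y.
  rewrite n0 dvd0z => /eqP k0; move: Gy; rewrite k0 !mulr0z; exact: fG.
have [d Pd dn] := dP _ _ n_gt0 (GP _ Gy0).
exists d => // k y Gy.
have /nP/dvdzP[q kq] : exists y, G (a *~ k, y) by exists y.
apply: (functionalP sG fG Gy).
have := subgroupMz q sG Gy0.
by rewrite /= in dn; rewrite pairMz kq mulrC !mulrzA -dn.
Qed.

(** Divisible groups are injective: by Zorn's lemma there is a maximal partial
    homomorphism, and it is total since it could otherwise be extended to one
    more element. *)
Lemma extend_graph (G0 : set (A * D)) (P : set D) :
  is_subgroup G0 -> functional G0 -> is_subgroup P -> divisible P ->
  (forall p, G0 p -> P p.2) ->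
  exists h : {additive A -> D},
    (forall x, P (h x)) /\ forall p, G0 p -> h p.1 = p.2.
Proof.
move=> sG0 fG0 sP dP G0P.
(* The empty set is admitted below as the union of the empty chain. *)
pose good (G : set (A * D)) := [/\ is_subgroup G, functional G,
  forall p, G p -> P p.2 & G0 `<=` G].
have [F goodF totF|G [Ggood Gmax]] :=
    @Zorn_bigcup _ [set G | G = set0 \/ good G].
  have [F0|/existsNP[G /not_implyP[FG G0n]]] :=
      pselect (forall G, F G -> G = set0).
    by left; rewrite -subset0 => p [G FG Gp]; rewrite -(F0 _ FG).
  have goodFn H p : F H -> H p -> good H.
    by move=> /goodF[->|].
  right; have [//|[sG _ _ G0G]] := goodF _ FG; split.
  - split; first by exists G => //; case: sG.
    move=> x y [H FH Hx] [K FK Ky].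
    have [HK|KH] := totF _ _ FH FK.
      exists K => //; have [sK _ _ _] := goodFn _ _ FK Ky.
      by apply: (proj2 sK) => //; apply: HK.
    exists H => //; have [sH _ _ _] := goodFn _ _ FH Hx.
    by apply: (proj2 sH) => //; apply: KH.
  - by move=> y [H FH Hy]; have [_ fH _ _] := goodFn _ _ FH Hy; apply: fH.
  - by move=> p [H FH Hp]; have [_ _ HP _] := goodFn _ _ FH Hp; apply: HP.
  - by move=> p /G0G Gp; exists G.
have {Ggood}[sG fG GP G0G] : good G.
  case: Ggood => // G_0; exfalso; apply: (Gmax G0); last by right; split.
  by rewrite G_0; split=> [p []|/(_ 0 (proj1 sG0))].
have total a : exists y, G (a, y).
  have [d Pd compat] := compatible_value a sG fG sP dP GP.
  have [sG' fG' G'P GG' G'a] := adjoin_graph sG fG sP GP Pd compat.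
  exists d; apply: contrapT => nGa; apply: (Gmax (adjoin G a d)).
    by split=> // /(_ _ G'a).
  by right; split=> //; apply: subset_trans GG'.
have /choice[h Gh] := total.
have hB : zmod_morphism h.
  move=> x y; apply: (functionalP sG fG (Gh _)).
  exact: (proj2 sG _ _ (Gh x) (Gh y)).
pose hM := GRing.isZmodMorphism.Build A D h hB.
pose H : {additive A -> D} := HB.pack h hM.
exists H; split=> [x|[x y] /G0G Gxy]; first exact: (GP _ (Gh x)).
exact: (functionalP sG fG (Gh x)).
Qed.

End Divisible.

(** * The group Q/Z *)

Definition fracpart (x : rat) : rat := x - (Num.floor x)%:~R.

Lemma fracpart_eq (x y : rat) :
  (fracpart x == fracpart y) = (x - y \is a Num.int).
Proof.
rewrite /fracpart; apply/eqP/idP => [xy|xyZ].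
  have -> : x - y = (Num.floor x)%:~R - (Num.floor y)%:~R.
    rewrite -[x in LHS](subrK (Num.floor x)%:~R) xy; ring.
  by rewrite rpredB ?intr_int.
have -> : x = y + (x - y) by ring.
rewrite (floorDrz y xyZ) intrD (floorK xyZ); ring.
Qed.

Lemma fracpartK (x : rat) : fracpart (fracpart x) == fracpart x.
Proof.
by rewrite fracpart_eq {1}/fracpart addrAC subrr add0r rpredN intr_int.
Qed.

(** Each class of rationals modulo the integers is represented by its fractional
    part. *)
Record QmodZ := QModZ { qzrep : rat; _ : fracpart qzrep == qzrep }.
HB.instance Definition _ := [isSub for qzrep].
HB.instance Definition _ := [Choice of QmodZ by <:].

Definition qz (x : rat) : QmodZ := QModZ (fracpartK x).

Lemma qz_eq (x y : rat) : (qz x == qz y) = (x - y \is a Num.int).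
Proof. by rewrite -fracpart_eq. Qed.

Lemma qzrepK : cancel qzrep qz.
Proof. by case=> x xP; apply: val_inj; apply/eqP. Qed.

Lemma qz_rep (x : rat) : qzrep (qz x) - x \is a Num.int.
Proof. by rewrite -qz_eq qzrepK. Qed.

Definition qz_add (u v : QmodZ) := qz (qzrep u + qzrep v).
Definition qz_opp (u : QmodZ) := qz (- qzrep u).

Lemma qz_addE (x y : rat) : qz_add (qz x) (qz y) = qz (x + y).
Proof.
by apply/eqP; rewrite qz_eq opprD addrACA rpredD ?qz_rep.
Qed.

Lemma qz_oppE (x : rat) : qz_opp (qz x) = qz (- x).
Proof. by apply/eqP; rewrite qz_eq -opprD rpredN qz_rep. Qed.

Fact qz_addA : associative qz_add.
Proof.
move=> u v w; rewrite -[u]qzrepK -[v]qzrepK -[w]qzrepK.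
by rewrite !qz_addE addrA.
Qed.

Fact qz_addC : commutative qz_add.
Proof. by move=> u v; rewrite /qz_add addrC. Qed.

Fact qz_add0 : left_id (qz 0) qz_add.
Proof. by move=> u; rewrite -[u]qzrepK qz_addE add0r. Qed.

Fact qz_addN : left_inverse (qz 0) qz_opp qz_add.
Proof. by move=> u; rewrite -[u]qzrepK qz_oppE qz_addE addNr. Qed.

HB.instance Definition _ := GRing.isZmodule.Build QmodZ
  qz_addA qz_addC qz_add0 qz_addN.

Fact qz_zmod_morphism : zmod_morphism qz.
Proof. by move=> x y; rewrite -qz_addE -qz_oppE. Qed.

HB.instance Definition _ :=
  GRing.isZmodMorphism.Build rat QmodZ qz qz_zmod_morphism.

Lemma QmodZ_divisible : divisible [set: QmodZ].
Proof.
move=> n u n_gt0 _; exists (qz (qzrep u / n%:R)) => //.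
rewrite -raddfMn -[_ *+ n]mulr_natr divfK; first exact: qzrepK.
by rewrite pnatr_eq0 -lt0n.
Qed.

Lemma fun_divisible (T : Type) (D : zmodType) :
  divisible [set: D] -> divisible [set: T -> D].
Proof.
move=> dD n f n_gt0 _.
have /choice[g gP] : forall t, exists c, c *+ n = f t.
  by move=> t; have [c _ cn] := dD n (f t) n_gt0 I; exists c.
exists g => //; apply/funext => t; rewrite -gP.
by elim: n {n_gt0 gP} => //= n; rewrite !mulrS => <-.
Qed.

Lemma setT_subgroup (D : zmodType) : is_subgroup [set: D].
Proof. by []. Qed.

(** [Q/Z] is a cogenerator: let [n] generate the integers [k] with [k a] in [B].
    Then the zero map on [B] extends by [a |-> 1/n], or by [a |-> 1/2] if [n] is
    0, and this value is nonzero because [n] is not 1. *)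
Lemma separate (A : zmodType) (B : set A) (a : A) :
  is_subgroup B -> ~ B a ->
  exists h : {additive A -> QmodZ}, (forall b, B b -> h b = 0) /\ h a <> 0.
Proof.
move=> sB nBa.
have [n nP] : exists n : nat, forall k : int, B (a *~ k) <-> (n %| k)%Z.
  apply: (@subgroup_int [set k | B (a *~ k)]).
  split; first by rewrite /= mulr0z; case: sB.
  by move=> k l /= Bk Bl; rewrite mulrzBr; apply: (proj2 sB).
pose m := if n is 0 then 2%N else n.
have m_gt1 : (1 < m)%N.
  rewrite /m; case: (n) (nP) => [|[|k]] // n1P.
  by case: nBa; rewrite -[a]mulr1z; apply/n1P.
have mP k : B (a *~ k) -> (m %| k)%Z.
  by move/nP; rewrite /m; case: (n) => // /[!dvd0z] /eqP ->; apply: dvdz0.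
have m0 : m%:R != 0 :> rat by rewrite pnatr_eq0 -lt0n ltnW.
pose G0 : set (A * QmodZ) := [set p | B p.1 /\ p.2 = 0].
have sG0 : is_subgroup G0.
  split; first by split=> //; case: sB.
  move=> [x y] [x' y'] [/= Bx ->] [/= Bx' ->]; split=> /=; last exact: subrr.
  exact: (proj2 sB).
have fG0 : functional G0 by move=> y [].
have compat k y : G0 (a *~ k, y) -> y = qz m%:R^-1 *~ k.
  move=> [/mP/dvdzP[q ->] /= ->]; apply/esym/eqP.
  rewrite -raddfMz -(raddf0 qz) qz_eq subr0 -mulrzr intrM mulrCA mulVf //.
  by rewrite mulr1 intr_int.
have [sG fG _ GG Ga] :=
  adjoin_graph sG0 fG0 (@setT_subgroup _) (fun _ _ => I) I compat.
have [h [_ hG]] := extend_graph sG fG (@setT_subgroup _) QmodZ_divisible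
  (fun _ _ => I).
exists h; split=> [b Bb|]; first exact: (hG (b, 0) (GG _ _)).
have floor0 : Num.floor (m%:R^-1 : rat) = 0.
  apply: floor_def; rewrite invr_ge0 ler0n add0r invf_lt1 ?ltr1n //.
  by rewrite ltr0n ltnW.
rewrite (hG _ Ga) /= => /eqP; rewrite -(raddf0 qz) qz_eq subr0 intrEfloor.
by rewrite floor0 eq_sym invr_eq0 (negbTE m0).
Qed.

(** * Coinduced modules *)

Section Coinduced.
Variables (R : pzRingType) (K : zmodType).

(** [coind] is [Hom_Z(R, K)], with the scalars acting through right
    multiplication on the argument. *)
Definition coind_pred : {pred R -> K} := fun h => `[< zmod_morphism h >].

Fact coind_zmod_closed : zmod_closed coind_pred.
Proof.
split; first by apply/asboolP => x y; rewrite subrr.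
move=> g h /asboolP gB /asboolP hB; apply/asboolP => x y.
by rewrite !fctE gB hB !opprD addrACA.
Qed.

HB.instance Definition _ :=
  GRing.isZmodClosed.Build (R -> K) coind_pred coind_zmod_closed.

Record coind := Coind { coind_fun :> R -> K; _ : coind_fun \in coind_pred }.

HB.instance Definition _ := [isSub for coind_fun].
HB.instance Definition _ := [Choice of coind by <:].
HB.instance Definition _ := [SubChoice_isSubZmodule of coind by <:].

Lemma coindB (h : coind) : zmod_morphism h.
Proof. by case: h => h /= /asboolP. Qed.

HB.instance Definition _ (h : coind) :=
  GRing.isZmodMorphism.Build R K h (coindB h).

Definition mk_coind (h : R -> K) (hB : zmod_morphism h) : coind :=
  Coind (introT (asboolP _) hB).

Lemma coindP (g h : coind) : (forall r, g r = h r) -> g = h.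
Proof. by move=> gh; apply/val_inj/funext. Qed.

Fact coind_scale_subproof (r : R) (h : coind) :
  zmod_morphism (fun s => h (s * r)).
Proof. by move=> x y; rewrite mulrBl raddfB. Qed.

Definition coind_scale r h := mk_coind (coind_scale_subproof r h).

Fact coind_scaleA r s h :
  coind_scale r (coind_scale s h) = coind_scale (r * s) h.
Proof. by apply: coindP => x /=; rewrite mulrA. Qed.

Fact coind_scale1 : left_id 1 coind_scale.
Proof. by move=> h; apply: coindP => x /=; rewrite mulr1. Qed.

Fact coind_scaleDr : right_distributive coind_scale +%R.
Proof. by move=> r g h; apply: coindP. Qed.

Fact coind_scaleDl h : {morph coind_scale^~ h : r s / r + s}.
Proof. by move=> r s; apply: coindP => x /=; rewrite mulrDr raddfD. Qed.

HB.instance Definition _ := GRing.Zmodule_isLmodule.Build R coind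
  coind_scaleA coind_scale1 coind_scaleDr coind_scaleDl.

Lemma coindZE (r s : R) (h : coind) : (r *: h) s = h (s * r).
Proof. by []. Qed.

Lemma coindDE (s : R) (g h : coind) : (g + h) s = g s + h s. Proof. by []. Qed.

(** One half of the adjunction between restriction of scalars and coinduction;
    the other half is evaluation at 1. *)
Lemma coind_transpose (V : lmodType R) (h : {additive V -> K}) :
  exists g : {linear V -> coind}, forall v r, g v r = h (r *: v).
Proof.
have gB v : zmod_morphism (fun r => h (r *: v)).
  by move=> r s; rewrite scalerBl raddfB.
pose g v : coind := mk_coind (gB v).
have gL : linear g.
  move=> r u v; apply: coindP => s.
  by rewrite coindDE coindZE /= scalerDr raddfD scalerA.
pose gM := GRing.isLinear.Build R V coind _ g gL.
pose G : {linear V -> coind} := HB.pack g gM.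
by exists G.
Qed.

(** By the adjunction, extending [g] amounts to extending the additive map
    [a |-> g a 1] along [i], which is possible since [P] is divisible. Tracking
    [P] makes this apply to [Hom_Z(R, P)] inside [Hom_Z(R, K)]. *)
Lemma coind_extend (P : set K) (A B : lmodType R) (i : {linear A -> B})
    (g : {linear A -> coind}) :
  is_subgroup P -> divisible P -> injective i -> (forall a r, P (g a r)) ->
  exists h : {linear B -> coind},
    (forall a, h (i a) = g a) /\ forall b r, P (h b r).
Proof.
move=> sP dP i_inj gP.
pose G0 : set (B * K) := [set p | exists a, p = (i a, g a 1)].
have sG0 : is_subgroup G0.
  split; first by exists 0; rewrite !raddf0.
  by move=> _ _ [a ->] [a' ->]; exists (a - a'); rewrite !raddfB.
have fG0 : functional G0.
  move=> y [a [ia ->]]; have -> : a = 0 by apply: i_inj; rewrite -ia raddf0.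
  by rewrite raddf0.
have [|k [kP kG]] := extend_graph sG0 fG0 sP dP.
  by move=> _ [a ->]; apply: gP.
have [h hE] := coind_transpose k.
exists h; split=> [a|b r]; last by rewrite hE.
apply: coindP => r; rewrite hE -linearZ.
rewrite (kG (i (r *: a), g (r *: a) 1)); last by exists (r *: a).
by rewrite /= linearZ coindZE mul1r.
Qed.

Lemma coind_injective : divisible [set: K] -> injective_module coind.
Proof.
move=> dK A B i g i_inj.
have [//|h [hE _]] := coind_extend (g := g) (@setT_subgroup K) dK i_inj.
by exists h.
Qed.

End Coinduced.

(** The map sends [v] to the family of all [h (r v)], for [h] a character of [V]
    that vanishes on [B]; these characters separate [B] from the elements
    outside of it. With [B] zero this embeds [V] into an injective module, and
    in general it embeds [V / B]. *)
Lemma submodule_kernel (R : pzRingType) (V : lmodType R) (B : set V) :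
  is_subgroup B -> (forall r v, B v -> B (r *: v)) ->
  exists (T : Type) (f : {linear V -> coind R (T -> QmodZ)}),
    forall v, f v = 0 <-> B v.
Proof.
move=> sB BZ.
pose T := {h : {additive V -> QmodZ} | forall b, B b -> h b = 0}.
have evB : zmod_morphism (fun (v : V) (h : T) => sval h v).
  by move=> u v; apply/funext => h; rewrite raddfB.
pose evM := GRing.isZmodMorphism.Build V (T -> QmodZ) _ evB.
pose ev : {additive V -> (T -> QmodZ)} :=
  HB.pack (fun (v : V) (h : T) => sval h v) evM.
have [f fE] := coind_transpose ev.
exists T, f => v; split=> [fv|Bv].
  apply: contrapT => nBv; have [h [hB hv]] := separate sB nBv.
  have := fE v 1; rewrite fv scale1r => /(congr1 (fun k => k (exist _ h hB))).
  by move=> /= /esym.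
apply: coindP => r; rewrite fE; apply/funext => h /=.
exact: (svalP h _ (BZ _ _ Bv)).
Qed.

(** * Finitely supported measures *)

Section FiniteMeasures.
Variables (Y : choiceType) (D : zmodType).
Implicit Types (X : set Y) (mu nu : set Y -> D).

(** The direct sum of copies of [D] indexed by [X] is encoded as a group of set
    functions on [Y], for [X] included in [Y]: the image of an element under a
    map of index sets is then a mere composition with the preimage, without
    sums over the fibers. *)
Definition finitely_additive mu : Prop :=
  forall A B, A `&` B = set0 -> mu (A `|` B) = mu A + mu B.

Definition finmeas X : set (set Y -> D) := [set mu | finitely_additive mu /\
  exists S, [/\ finite_set S, S `<=` X & forall A, A `&` S = set0 -> mu A = 0]].

Definition dirac (y : Y) (d : D) : set Y -> D :=
  fun A => if `[< A y >] then d else 0.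

Lemma dirac_in y d (A : set Y) : A y -> dirac y d A = d.
Proof. by move=> Ay; rewrite /dirac asboolT. Qed.

Lemma dirac_out y d (A : set Y) : ~ A y -> dirac y d A = 0.
Proof. by move=> Ay; rewrite /dirac asboolF. Qed.

Fact dirac_zmod_morphism y : zmod_morphism (dirac y).
Proof.
move=> d e; apply/funext => A; rewrite !fctE /dirac.
by case: ifP; rewrite ?subr0.
Qed.

HB.instance Definition _ y :=
  GRing.isZmodMorphism.Build D (set Y -> D) (dirac y) (dirac_zmod_morphism y).

Lemma finitely_additiveB mu nu : finitely_additive mu -> finitely_additive nu ->
  finitely_additive (mu - nu).
Proof.
by move=> am an A B AB; rewrite !fctE am // an // opprD addrACA.
Qed.

Lemma finmeas_subgroup X : is_subgroup (finmeas X).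
Proof.
split.
  split; first by move=> A B _; rewrite addr0.
  by exists set0; split.
move=> mu nu [am [S [Sfin SX S0]]] [an [T [Tfin TX T0]]]; split.
  exact: finitely_additiveB.
exists (S `|` T); split; first by rewrite finite_setU.
  by move=> y [/SX|/TX].
move=> A; rewrite setIUr setU_eq0 => -[AS AT].
by rewrite !fctE S0 // T0 // subrr.
Qed.

Lemma dirac_additive y d : finitely_additive (dirac y d).
Proof.
move=> A B AB.
have [Ay|nAy] := pselect (A y); have [By|nBy] := pselect (B y).
- by have : set0 y by rewrite -AB.
- by rewrite (dirac_in _ Ay) (dirac_out _ nBy) dirac_in ?addr0 //; left.
- by rewrite (dirac_in _ By) (dirac_out _ nAy) dirac_in ?add0r //; right.
- by rewrite !dirac_out ?addr0 // => -[].
Qed.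

Lemma dirac_finmeas X y d : X y -> finmeas X (dirac y d).
Proof.
move=> Xy; split; first exact: dirac_additive.
exists [set y]; split=> [||A Ay]; first exact: finite_set1.
  by move=> _ ->.
apply: dirac_out => Ay'.
by have : set0 y by rewrite -Ay.
Qed.

Lemma measD mu A B : finitely_additive mu -> mu A = mu (A `&` B) + mu (A `\` B).
Proof. by move=> am; rewrite -am ?setUIDK // setIACA setICr setI0. Qed.

Lemma finmeas_agree X mu A B : finmeas X mu ->
  (forall y, X y -> (A y <-> B y)) -> mu A = mu B.
Proof.
move=> [am [S [Sfin SX S0]]] AB.
rewrite (measD A B am) (measD B A am) setIC; congr (_ + _).
rewrite !S0 //; apply/seteqP; split=> // y [[ABy nABy] Sy]; apply: nABy.
  by apply/AB => //; apply: SX.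
by apply/AB => //; apply: SX.
Qed.

(** Such a measure is the sum of its point masses; this is what identifies
    [finmeas X] with the direct sum. By induction on the support, subtract the
    mass of one point at a time. *)
Lemma finmeas_sum_dirac X mu : finmeas X mu ->
  exists2 s : seq Y, (forall y, y \in s -> X y) &
    mu = \sum_(y <- s) dirac y (mu [set y]).
Proof.
move=> [am [S [/finite_seqP[s0 ->] sX S0]]].
exists (undup s0) => [y|]; first by rewrite mem_undup; apply: sX.
have : forall A, (forall y, y \in undup s0 -> ~ A y) -> mu A = 0.
  move=> A As; apply: S0; apply/seteqP; split=> // y [Ay /= ys].
  by apply: (As y); rewrite ?mem_undup.
elim: (undup s0) (undup_uniq s0) mu am {S0} =>
    [_|y s IHs /andP[ys us]] mu am mus.
  by rewrite big_nil; apply/funext => A; apply: mus.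
pose nu := mu - dirac y (mu [set y]).
have an : finitely_additive nu by apply/finitely_additiveB/dirac_additive.
have nu_mu z : z \in s -> nu [set z] = mu [set z].
  move=> zs; rewrite /nu !fctE dirac_out ?subr0 // => /= yz.
  by move: ys; rewrite yz zs.
rewrite big_cons; under eq_big_seq => z zs do rewrite -nu_mu //.
rewrite -IHs //; first by rewrite /nu addrC subrK.
move=> A As; rewrite /nu !fctE.
have [Ay|nAy] := pselect (A y).
  rewrite dirac_in // (measD A [set y] am) (mus (A `\` _)); last first.
    by move=> z; rewrite inE => /predU1P[-> [_ /(_ erefl)]|/As nAz []].
  rewrite addr0 (_ : A `&` [set y] = [set y]) ?subrr //.
  by apply/setIidr => _ ->.
rewrite dirac_out // mus ?subr0 // => z.
by rewrite inE => /predU1P[->|/As].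
Qed.

Lemma finmeas_point X mu : finmeas X mu -> mu <> 0 ->
  exists2 y, X y & mu [set y] <> 0.
Proof.
move=> /finmeas_sum_dirac[s sX muE] mu0; apply: contrapT => none.
apply: mu0; rewrite muE big_seq big1 // => y /sX Xy.
have -> : mu [set y] = 0 by apply: contrapT => ny; apply: none; exists y.
exact: raddf0.
Qed.

Lemma finmeas_divisible X : divisible [set: D] -> divisible (finmeas X).
Proof.
move=> dD n mu n_gt0 /finmeas_sum_dirac[s sX ->].
have /choice[c cP] : forall y, exists c, c *+ n = mu [set y].
  by move=> y; have [c _ cn] := dD n (mu [set y]) n_gt0 I; exists c.
exists (\sum_(y <- s) dirac y (c y)).
  rewrite big_seq; elim/big_ind: _ => [|u v|y ys].
  - by case: (finmeas_subgroup X).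
  - by apply: subgroupD; apply: finmeas_subgroup.
  - exact/dirac_finmeas/sX.
by rewrite -sumrMnl; apply: eq_bigr => y _; rewrite -cP raddfMn.
Qed.

End FiniteMeasures.

Section Pushforward.
Variables (Y : choiceType) (D : zmodType).
Implicit Types (X : set Y) (mu nu : set Y -> D) (p : Y -> Y).

Definition push p mu : set Y -> D := fun A => mu (p @^-1` A).

Fact push_zmod_morphism p : zmod_morphism (push p).
Proof. by []. Qed.

HB.instance Definition _ p :=
  GRing.isZmodMorphism.Build (set Y -> D) (set Y -> D) (push p)
    (push_zmod_morphism p).

Lemma finmeas_push X X' p mu : (forall y, X y -> X' (p y)) ->
  finmeas X mu -> finmeas X' (push p mu).
Proof.
move=> pX [am [S [Sfin SX S0]]]; split.
  by move=> A B AB; rewrite /push preimage_setU am // -preimage_setI AB.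
exists (p @` S); split; first exact: finite_image.
  by move=> _ [y /SX Xy <-]; apply: pX.
move=> A AS; apply: S0; apply/seteqP; split=> // y [Ay Sy].
by have : set0 (p y) by rewrite -AS; split=> //; exists y.
Qed.

Lemma push_fix X p mu : (forall y, X y -> p y = y) -> finmeas X mu ->
  push p mu = mu.
Proof.
move=> pX muX; apply/funext => A; apply: (finmeas_agree muX) => y Xy.
by rewrite /preimage /= pX.
Qed.

End Pushforward.

(** * Finite-to-one functions on countable ordinals *)

Section FiniteToOne.

Definition omega1_fun : Type := omega1 -> nat.
HB.instance Definition _ := gen_eqMixin omega1_fun.
HB.instance Definition _ := gen_choiceMixin omega1_fun.
Implicit Types (a b c : omega1) (e : omega1_fun).

(** A function defined on the ordinals up to [a] is encoded as a total function
    that vanishes beyond [a]; only its values up to [a] count for being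
    finite-to-one. *)
Definition fin_to_one a : set omega1_fun := [set e |
  (forall c, ~~ (c <= a)%O -> e c = 0%N) /\
  (forall n, finite_set [set c | (c <= a)%O /\ e c = n])].

Definition restr a e : omega1_fun := fun c => if (c <= a)%O then e c else 0%N.

Definition overwrite a e e' : omega1_fun :=
  fun c => if (c <= a)%O then e c else e' c.

(** The segment below [a] is countable, hence injects into the integers. *)
Lemma fin_to_one_nonempty a : exists e, fin_to_one a e.
Proof.
have /asboolP/countable_injP[f fI] := valP a.
exists (restr a (f \o val)); split=> [c|n].
  by rewrite /restr => /negbTE ->.
apply: (@sub_finite_set _ _ [set c | (c <= a)%O /\ f (val c) = n]).
  by move=> c [ca]; rewrite /restr ca.
have [[c0 [c0a fc0]]|none] :=
  pselect (exists c, (c <= a)%O /\ f (val c) = n).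
  apply: (@sub_finite_set _ _ [set c0]); last exact: finite_set1.
  move=> c [ca fc]; apply/val_inj/fI.
  - exact: (mem_set ca).
  - exact: (mem_set c0a).
  - by rewrite fc0 fc.
apply: (@sub_finite_set _ _ set0) => // c cP.
by case: none; exists c.
Qed.

Lemma restr_fin_to_one a b e : (a <= b)%O -> fin_to_one b e ->
  fin_to_one a (restr a e).
Proof.
move=> ab [_ eb]; split=> [c|n]; first by rewrite /restr => /negbTE ->.
apply: sub_finite_set (eb n) => c [ca]; rewrite /restr ca => <-.
by split=> //; apply: le_trans ab.
Qed.

Lemma overwrite_fin_to_one a b e e' : (a <= b)%O -> fin_to_one a e ->
  fin_to_one b e' -> fin_to_one b (overwrite a e e').
Proof.
move=> ab [_ ea] [e'0 eb]; split=> [c ncb|n].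
  rewrite /overwrite ifF ?e'0 //; apply/negbTE; apply: contra ncb => ca.
  exact: le_trans ab.
have := conj (ea n) (eb n); rewrite -finite_setU; apply: sub_finite_set.
by move=> c [cb]; rewrite /overwrite; case: ifP => ca ec; [left|right].
Qed.

Lemma restr_overwrite a e e' : fin_to_one a e -> restr a (overwrite a e e') = e.
Proof.
move=> [e0 _]; apply/funext => c; rewrite /restr /overwrite.
by case: ifP => ca; [rewrite ca | rewrite e0 ?ca].
Qed.

Lemma restr_id a e : fin_to_one a e -> restr a e = e.
Proof.
move=> [e0 _]; apply/funext => c; rewrite /restr.
by case: ifP => // ca; rewrite e0 ?ca.
Qed.

Lemma restr_restr a b e : (a <= b)%O -> restr a (restr b e) = restr a e.
Proof.
move=> ab; apply/funext => c; rewrite /restr; case: ifP => // ca.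
by rewrite (le_trans ca ab).
Qed.

(** The number of elements of [S] up to [b] is strictly increasing in [b] over
    [S], so that it injects [S] into the integers. *)
Lemma countable_of_finite_segments (S : set omega1) :
  (forall b, finite_set [set c | (c <= b)%O /\ S c]) -> countable S.
Proof.
move=> Sfin; pose seg b := fset_set [set c | (c <= b)%O /\ S c].
have lt_card b c : S c -> (b < c)%O -> (#|` seg b| < #|` seg c|)%N.
  move=> Sc bc; apply: fproper_ltn_card; rewrite fproperE; apply/andP; split.
    apply/fsubsetP => x; rewrite !in_fset_set // => /set_mem[xb Sx].
    by apply: mem_set; split=> //; apply: le_trans (ltW bc).
  apply/fsubsetPn; exists c; first by rewrite in_fset_set //; apply: mem_set.
  rewrite in_fset_set //; apply/negP => /set_mem[cb _].
  by move: cb; rewrite leNgt bc.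
apply/countable_injP; exists (fun b => #|` seg b|).
move=> b c /set_mem Sb /set_mem Sc bc.
by have [/(lt_card _ _ Sc)|/(lt_card _ _ Sb)|//] := ltgtP b c;
  rewrite bc ltnn.
Qed.

Lemma no_fin_to_one_omega1 (n : omega1 -> nat) :
  ~ (forall b k, finite_set [set c | (c <= b)%O /\ n c = k]).
Proof.
move=> nfin; apply: omega1_uncountable.
have -> : [set: omega1] = \bigcup_k [set c | n c = k].
  by apply/seteqP; split=> c // _; exists (n c).
apply: bigcup_countable => // k _.
by apply: countable_of_finite_segments => b; apply: nfin.
Qed.

(** Elements charged by the measures at different stages need not be
    compatible with each other, but each of them is the restriction of one
    charged at any later stage. The diagonal [c |-> e c c] is therefore
    finite-to-one below every [b]. *)
Lemma fin_to_one_thread_eq0 (D : zmodType)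
    (mu : omega1 -> set omega1_fun -> D) :
  (forall a, finmeas (fin_to_one a) (mu a)) ->
  (forall a b, (a <= b)%O -> push (restr a) (mu b) = mu a) ->
  forall a, mu a = 0.
Proof.
move=> muX mu_restr a; apply: contrapT => mua.
have mu_max c : exists e, mu (Order.max a c) [set e] <> 0.
  have [|e _] := finmeas_point (muX (Order.max a c)); last by exists e.
  move=> mu0; apply: mua; rewrite -(mu_restr a (Order.max a c)) ?mu0 //.
  by rewrite le_max lexx.
have [e eP] := choice mu_max.
apply: (@no_fin_to_one_omega1 (fun c => e c c)) => b k.
(* All the [e c] with [c <= b] are restrictions of elements of the finite
   support [S] at the common later stage [m]. *)
pose m := Order.max a b.
have [_ [S [Sfin SX S0]]] := muX m.
apply: (@sub_finite_set _ _
    (\bigcup_(s in S) [set c | (c <= m)%O /\ s c = k])); last first.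
  by apply: bigcup_finite => // s /SX[].
move=> c [cb eck].
have acm : (Order.max a c <= m)%O.
  by rewrite ge_max le_max lexx /= le_max cb orbT.
have [s [Ss es]] : exists s, S s /\ restr (Order.max a c) s = e c.
  apply: contrapT => none; apply: (eP c); rewrite -(mu_restr _ _ acm).
  apply: S0; apply/seteqP; split=> // s [/= es Ss].
  by case: none; exists s.
exists s => //; split; first by rewrite le_max cb orbT.
by rewrite -eck -es /restr le_max lexx orbT.
Qed.

End FiniteToOne.

(** * Submodules as modules *)

Section Submodule.
Variables (R : pzRingType) (W : lmodType R).

Record submodule := Submodule {
  submodule_set :> W -> Prop;
  submodule0 : submodule_set 0;
  submoduleP : forall r u v,
    submodule_set u -> submodule_set v -> submodule_set (r *: u + v)
}.

Variable S : submodule.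

Definition submodule_pred : {pred W} := fun w => `[< S w >].

Fact submodule_pred_closed : submod_closed submodule_pred.
Proof.
split; first exact/asboolP/submodule0.
by move=> r u v /asboolP Su /asboolP Sv; apply/asboolP/submoduleP.
Qed.

HB.instance Definition _ :=
  GRing.isSubmodClosed.Build R W submodule_pred submodule_pred_closed.

Record submodule_type := SubmoduleElt {
  submodule_val :> W; _ : submodule_val \in submodule_pred }.

HB.instance Definition _ := [isSub for submodule_val].
HB.instance Definition _ := [Choice of submodule_type by <:].
HB.instance Definition _ := [SubChoice_isSubLmodule of submodule_type by <:].

Lemma submodule_valP (w : submodule_type) : S w.
Proof. by case: w => w /= /asboolP. Qed.

Definition submodule_elt (w : W) (Sw : S w) : submodule_type :=
  SubmoduleElt (introT (asboolP _) Sw).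

Fact submodule_val_linear : linear submodule_val.
Proof. by []. Qed.

HB.instance Definition _ := GRing.isLinear.Build R submodule_type W _
  submodule_val submodule_val_linear.

End Submodule.

Section SubmoduleMap.
Variables (R : pzRingType) (V W : lmodType R) (S : submodule W).

Fact corestriction_linear (f : {linear V -> W}) (fS : forall v, S (f v)) :
  linear (fun v => submodule_elt (fS v)).
Proof. by move=> r u v; apply: val_inj; rewrite /= linearP. Qed.

Definition corestriction (f : {linear V -> W}) (fS : forall v, S (f v)) :
    {linear V -> submodule_type S} :=
  HB.pack (fun v => submodule_elt (fS v))
    (GRing.isLinear.Build R V (submodule_type S) _ _ (corestriction_linear fS)).

Variable T : submodule V.

Fact restriction_linear (f : {linear V -> W})
    (fTS : forall v, T v -> S (f v)) :
  linear (fun v : submodule_type T => submodule_elt (fTS v (submodule_valP v))).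
Proof. by move=> r u v; apply: val_inj; rewrite /= linearP. Qed.

Definition restriction (f : {linear V -> W}) (fTS : forall v, T v -> S (f v)) :
    {linear submodule_type T -> submodule_type S} :=
  HB.pack (fun v : submodule_type T => submodule_elt (fTS v (submodule_valP v)))
    (GRing.isLinear.Build R (submodule_type T) (submodule_type S) _ _
       (restriction_linear fTS)).

End SubmoduleMap.

(** * The inverse system *)

Section System.
Variables (R : pzRingType) (E : lmodType R) (D : zmodType).
Variable f : {linear E -> coind R D}.
Hypotheses (E_inj : injective_module E) (D_div : divisible [set: D]).

Local Notation W := (E * coind R (set omega1_fun -> D))%type.

Fact stage_subproof0 a : forall r : R,
  finmeas (fin_to_one a) ((0 : W).2 r) /\ (0 : W).2 r setT = f (0 : W).1 r.
Proof.
move=> r; rewrite [f _](linear0 f); split=> //.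
exact: (finmeas_subgroup D (fin_to_one a)).1.
Qed.

Fact stage_subproof a (s : R) (u v : W) :
  (forall r, finmeas (fin_to_one a) (u.2 r) /\ u.2 r setT = f u.1 r) ->
  (forall r, finmeas (fin_to_one a) (v.2 r) /\ v.2 r setT = f v.1 r) ->
  forall r, finmeas (fin_to_one a) ((s *: u + v).2 r) /\
            (s *: u + v).2 r setT = f (s *: u + v).1 r.
Proof.
move=> uP vP r; have [um ut] := uP (r * s); have [vm vt] := vP r.
rewrite /= linearP !coindDE !coindZE; split.
  by apply: subgroupD => //; apply: finmeas_subgroup.
by rewrite -ut -vt.
Qed.

(** All the stages are submodules of the same module [W], as the functions of
    [fin_to_one a] are all in [omega1_fun]; the transition maps are then the
    restrictions of endomorphisms of [W]. *)
Definition stage (a : omega1) : submodule W :=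
  Submodule (@stage_subproof0 a) (@stage_subproof a).

Fact coind_push_subproof (p : omega1_fun -> omega1_fun)
    (h : coind R (set omega1_fun -> D)) :
  zmod_morphism (fun r => push p (h r)).
Proof. by move=> r s; rewrite !raddfB. Qed.

Fact stage_push_linear (p : omega1_fun -> omega1_fun) :
  linear (fun w : W => (w.1, mk_coind (coind_push_subproof p w.2)) : W).
Proof.
by move=> r u v; congr (_, _); apply: coindP.
Qed.

Definition stage_push (p : omega1_fun -> omega1_fun) : {linear W -> W} :=
  HB.pack (fun w : W => (w.1, mk_coind (coind_push_subproof p w.2)) : W)
    (GRing.isLinear.Build R W W _ _ (stage_push_linear p)).

Lemma stage_pushP a b p : (forall e, fin_to_one a e -> fin_to_one b (p e)) ->
  forall w, stage a w -> stage b (stage_push p w).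
Proof.
move=> pab w wa r; have [wm wt] := wa r; split; last exact: wt.
exact: finmeas_push wm.
Qed.

Lemma stage_push_comp p q w :
  stage_push p (stage_push q w) = stage_push (p \o q) w.
Proof. by congr (_, _); apply: coindP. Qed.

Lemma stage_push_fix a p w : (forall e, fin_to_one a e -> p e = e) ->
  stage a w -> stage_push p w = w.
Proof.
move=> pa wa; case: w wa => x h wa; congr (_, _); apply: coindP => r /=.
exact: push_fix pa (wa r).1.
Qed.

Definition stage_map a b (ab : (a <= b)%O) :
    {linear submodule_type (stage b) -> submodule_type (stage a)} :=
  restriction (stage_pushP (fun e => @restr_fin_to_one a b e ab)).

Fact stage_map_id a (aa : (a <= a)%O) x : stage_map aa x = x.
Proof.
apply: val_inj; apply: (@stage_push_fix a); last exact: submodule_valP.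
by move=> e ea; apply: restr_id.
Qed.

Fact stage_map_comp a b c
    (ab : (a <= b)%O) (bc : (b <= c)%O) (ac : (a <= c)%O) x :
  stage_map ab (stage_map bc x) = stage_map ac x.
Proof.
apply: val_inj; rewrite [LHS]stage_push_comp; congr (stage_push _ _).
by apply/funext => e /=; apply: restr_restr.
Qed.

Definition stage_system : inverse_system R omega1 :=
  InverseSystem stage_map_id stage_map_comp.

(** Extend the functions on the ordinals up to [a] by the values of a fixed
    finite-to-one [e]; restricting back to [a] undoes the extension. *)
Lemma stage_map_split a b (ab : (a <= b)%O) : split_epi (stage_map ab).
Proof.
have [e eb] := fin_to_one_nonempty b.
have ext x : fin_to_one a x -> fin_to_one b (overwrite a x e).
  by move=> xa; apply: overwrite_fin_to_one.
exists (restriction (stage_pushP ext)) => y; apply: val_inj.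
rewrite [LHS]stage_push_comp; apply: (@stage_push_fix a).
  by move=> x xa /=; apply: restr_overwrite.
exact: submodule_valP.
Qed.

(** The defect [f x r - mass (h r)] is additive in [r], and putting it as a mass
    at [e] in [fin_to_one a] gives a linear retraction onto the stage of the
    pairs [(x, h)] such that [h] takes its values in the measures on
    [fin_to_one a]. *)
Fact retract_subproof (e : omega1_fun) (w : W) :
  zmod_morphism (fun r => dirac e (f w.1 r - w.2 r setT)).
Proof.
move=> r s; rewrite -raddfB; congr dirac.
by rewrite !coindB fctE !opprD addrACA.
Qed.

Definition retract e (w : W) : W :=
  (w.1, w.2 + mk_coind (@retract_subproof e w)).

Fact retract_linear e : linear (retract e).
Proof.
move=> r u v; congr (_, _); apply: coindP => s.
rewrite !coindDE !coindZE !coindDE /= addrACA; congr (_ + _).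
rewrite -raddfD; congr dirac; rewrite linearP coindDE coindZE.
by rewrite opprD addrACA.
Qed.

HB.instance Definition _ e := GRing.isLinear.Build R W W _ (retract e)
  (retract_linear e).

Lemma retract_stage a e (w : W) : fin_to_one a e ->
  (forall r, finmeas (fin_to_one a) (w.2 r)) -> stage a (retract e w).
Proof.
move=> ea wm r; split.
  apply: subgroupD; [exact: finmeas_subgroup|exact: wm|exact: dirac_finmeas].
transitivity ((w.2 r + dirac e (f w.1 r - w.2 r setT)) setT) => //.
by rewrite fctE dirac_in // addrC subrK.
Qed.

Lemma retract_fix a e w : stage a w -> retract e w = w.
Proof.
case: w => x h wa; congr (_, _); apply: coindP => r.
rewrite coindDE /=; have [_ /= ->] := wa r.
by rewrite subrr raddf0 addr0.
Qed.

(** Extend the two components separately, the second one with values in the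
    measures on [fin_to_one a], and then apply the retraction. It does not
    change the values on [A], which already lie in the stage. *)
Lemma stage_injective a : injective_module (submodule_type (stage a)).
Proof.
move=> A B i g i_inj; have [e ea] := fin_to_one_nonempty a.
pose g1 : {linear A -> E} := fst \o (@submodule_val _ _ (stage a)) \o g.
pose g2 : {linear A -> coind R (set omega1_fun -> D)} :=
  snd \o (@submodule_val _ _ (stage a)) \o g.
have [x xE] := E_inj g1 i_inj.
have [||y [yE yP]] := coind_extend (g := g2) (finmeas_subgroup D (fin_to_one a))
   _ i_inj.
- exact: finmeas_divisible.
- by move=> v r; have [] := submodule_valP (g v) r.
have xy_linear : linear (fun b => retract e (x b, y b)).
  move=> r u v; rewrite -linearP; congr (retract e).
  by rewrite /= !linearP.
pose xyM := GRing.isLinear.Build R B W _ _ xy_linear.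
pose xy : {linear B -> W} := HB.pack (fun b => retract e (x b, y b)) xyM.
exists (@corestriction _ _ _ (stage a) xy
  (fun b => retract_stage (w := (x b, y b)) ea (yP b))) => v.
apply: val_inj; rewrite /= xE yE -surjective_pairing.
exact: retract_fix (submodule_valP (g v)).
Qed.

(** In a compatible family, the second components vanish since there is no
    nonzero compatible family of measures, and the first components are all
    equal to one [x], as the transition maps do not change them. Mass 0 then
    means [f x = 0]. *)
Lemma stage_system_lim (M : lmodType R) (m : {linear M -> E}) :
  injective m -> (forall x, f x = 0 <-> exists y, x = m y) ->
  lmod_isomorphic M (invlim stage_system).
Proof.
move=> m_inj fP.
have m_stage a y : stage a (m y, 0).
  move=> r; have -> : f (m y) = 0 by apply/fP; exists y.
  by split=> //; apply: (finmeas_subgroup D (fin_to_one a)).1.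
have thread_proof y a b (ab : (a <= b)%O) :
    stage_map ab (submodule_elt (m_stage b y)) = submodule_elt (m_stage a y).
  by apply: val_inj; congr (_, _); apply: coindP.
pose F y : invlim stage_system := @InvLim _ _ _ stage_system _ (thread_proof y).
have F_linear : linear F.
  move=> r u v; apply: invlim_eq => a; apply: val_inj.
  by rewrite /= linearP; congr (_, _); rewrite /= scaler0 addr0.
pose FM := GRing.isLinear.Build R M (invlim stage_system) _ F F_linear.
pose G : {linear M -> invlim stage_system} := HB.pack F FM.
exists G.
have [a0 _] : [set: omega1] !=set0.
  apply/set0P/eqP => T0; apply: omega1_uncountable.
  by rewrite T0; apply: countable0.
have G_inj : injective G.
  pose first (t : invlim stage_system) := (submodule_val (t a0)).1.
  move=> u v /(congr1 first).
  exact: m_inj.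
have G_surj t : exists y, G y = t.
  pose mu r a := (submodule_val (t a)).2 r.
  have mu0 r a : mu r a = 0.
    apply: fin_to_one_thread_eq0 => [b|b c bc].
      by have [] := submodule_valP (t b) r.
    by rewrite /mu -(threadP t bc).
  have const a : (submodule_val (t a)).1 = (submodule_val (t a0)).1.
    have le b c (bc : (b <= c)%O) :
        (submodule_val (t b)).1 = (submodule_val (t c)).1.
      by rewrite -(threadP t bc).
    by case/orP: (le_total a a0) => [/le|/le].
  have /fP[y yE] : f (submodule_val (t a0)).1 = 0.
    apply: coindP => r; have [_ <-] := submodule_valP (t a0) r.
    by have := mu0 r a0; rewrite /mu => ->.
  exists y; apply: invlim_eq => a; apply: val_inj => /=.
  rewrite [RHS]surjective_pairing const -yE; congr (_, _).
  by apply: coindP => r; rewrite -[RHS]/(mu r a) mu0.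
have /choice[H GK] := G_surj.
by exists H => [y|//]; apply: G_inj.
Qed.
End System.

(** * Every module is an inverse limit of injective modules *)

Theorem theoremA (R : pzRingType) (M : lmodType R) :
  exists I : inverse_system R omega1,
    (forall a : omega1, injective_module (I a)) /\
    (forall (a b : omega1) (ab : (a <= b)%O), split_epi (is_map I ab)) /\
    lmod_isomorphic M (invlim I).
Proof.
have [T [m mP]] : exists (T : Type) (m : {linear M -> coind R (T -> QmodZ)}),
    forall y, m y = 0 <-> y = 0.
  apply: (@submodule_kernel R M [set 0]) => [|r _ ->]; last by rewrite scaler0.
  by split=> // x y -> ->; rewrite subrr.
have m_inj : injective m.
  move=> x y mxy; apply/eqP; rewrite -subr_eq0; apply/eqP/mP.
  by rewrite linearB mxy subrr.
have [||T' [f fP]] := @submodule_kernel R (coind R (T -> QmodZ))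
  [set x | exists y, x = m y].
- split; first by exists 0; rewrite linear0.
  by move=> _ _ [x ->] [y ->]; exists (x - y); rewrite linearB.
- by move=> r _ [y ->]; exists (r *: y); rewrite linearZ.
have QT_div U : divisible [set: U -> QmodZ].
  exact/fun_divisible/QmodZ_divisible.
exists (stage_system f); split; last split.
- by move=> a; apply: stage_injective; [apply: coind_injective|]; apply: QT_div.
- by move=> a b ab; apply: (stage_map_split f ab).
- exact: stage_system_lim m_inj fP.
Qed.
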